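(* In the setting described in the context, assume that the penalty-DC-method generates an (infinite) sequence $\{(x^k,y^k)\}_{k\in\mathbb{N}}\subset\mathbb{R}^n\times\mathbb{R}^m$, and let $(\bar x,\bar y)\in\mathbb{R}^n\times\mathbb{R}^m$ be an accumulation point of this sequence which is feasible for the bilevel problem (BPP). Then there exist multipliers $\lambda,\lambda'\in\mathbb{R}^p$, $\mu\in\mathbb{R}^q$, and $\sigma\ge0$ such that $$\begin{aligned} &0=\nabla_xf(\bar x,\bar y)+A^\top(\lambda-\sigma\lambda')+C^\top\mu,\\ &0=\nabla_yf(\bar x,\bar y)+B^\top(\lambda-\sigma\lambda')+D^\top\mu,\\ &0\le\lambda\perp b-A\bar x-B\bar y,\\ &0\le\mu\perp d-C\bar x-D\bar y,\\ &0=c+B^\top\lambda',\qquad 0\le\lambda'\perp b-A\bar x-B\bar y. \end{aligned}$$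
   Context: Data: $A\in\mathbb{R}^{p\times n}$, $B\in\mathbb{R}^{p\times m}$, $C\in\mathbb{R}^{q\times n}$, $D\in\mathbb{R}^{q\times m}$, $b\in\mathbb{R}^p$, $c\in\mathbb{R}^m$, $d\in\mathbb{R}^q$; $f=f_1-f_2$ with $f_1,f_2\colon\mathbb{R}^n\times\mathbb{R}^m\to\mathbb{R}$ convex and continuously differentiable. For $x\in\mathbb{R}^n$, $\Psi(x)$ is the solution set of the linear program $\min_y\{c^\top y\mid Ax+By\le b\}$ and $\vartheta(x)=\inf_y\{c^\top y\mid Ax+By\le b\}$ its optimal value, with $\operatorname{dom}\vartheta=\{x\mid|\vartheta(x)|<\infty\}$; $\vartheta$ is convex and piecewise affine. The bilevel problem is $$\text{(BPP)}\qquad\min_{x,y}\{f(x,y)\mid Cx+Dy\le d,\ y\in\Psi(x)\}.$$ Let $\mathcal Z_\ell=\{(x,y)\mid Ax+By\le b\}$ and $\mathcal Z_u=\{(x,y)\mid Cx+Dy\le d\}$. Standing assumptions: $\{x\mid\exists y:\ (x,y)\in\mathcal Z_\ell\}\subset\operatorname{int}\operatorname{dom}\vartheta$, and $\mathcal Z_u\cap\mathcal Z_\ell$ is nonempty and compact. Penalty-DC-method: choose $\sigma^0>0$, $\gamma>1$, $(x^0,y^0)\in\mathcal Z_u\cap\mathcal Z_\ell$; for $k=0,1,2,\ldots$, compute (with a boosted DC-algorithm started at $(x^k,y^k)$) a $\partial^{\mathrm c}$-stationary point $(x^{k+1},y^{k+1})$ of $$\min_{x,y}\{f_1(x,y)+\sigma^kc^\top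 y-(f_2(x,y)+\sigma^k\vartheta(x))\mid Ax+By\le b,\ Cx+Dy\le d\};$$ stop if $y^{k+1}\in\Psi(x^{k+1})$; otherwise set $\sigma^{k+1}=\gamma\sigma^k$ and continue. It is assumed that the method does not stop, so it generates an infinite sequence. Here a $\partial^{\mathrm c}$-stationary point of a DC-problem $\min\{g(w)-h(w)\mid\tilde Aw\le\tilde b\}$ ($g,h$ convex, $g$ continuously differentiable) is a feasible point $w$ for which there is $\zeta$ with $0\in\nabla g(w)-\partial h(w)+\tilde A^\top\zeta$ and $0\le\zeta\perp\tilde b-\tilde Aw$, where $\partial h$ is the convex subdifferential. Vector inequalities are componentwise; $0\le u\perp v$ means $u\ge0$ and $u^\top v=0$. *)

(* Defs.v *)
From HB Require Import structures.
From mathcomp Require Import all_boot all_order all_algebra.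
From mathcomp Require Import all_classical all_reals all_analysis.

Set Implicit Arguments.
Unset Strict Implicit.
Unset Printing Implicit Defensive.

Import Order.TTheory GRing.Theory Num.Theory.
Import numFieldNormedType.Exports.

Local Open Scope classical_set_scope.
Local Open Scope ring_scope.

(* A point (x, y) of R^n x R^m is the stacked column col_mx x y : 'cV_(n + m);
   its components are usubmx (for x) and dsubmx (for y). *)

Section vectors.
Context {R : realType} {N : nat}.
Implicit Types u v : 'cV[R]_N.

Definition vle u v : Prop := forall i, u i 0 <= v i 0.

Definition dot u v : R := (u^T *m v) 0 0.

(* 0 <= u _|_ v; the sign of v is not part of the condition. *)
Definition nneg_perp u v : Prop := vle 0 u /\ dot u v = 0.

Definition grad (f : 'cV[R]_N -> R) (w : 'cV[R]_N) : 'cV[R]_N :=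
  \col_i 'D_(delta_mx i 0) f w.

Definition continuously_differentiable (f : 'cV[R]_N -> R) : Prop :=
  (forall w, differentiable f w) /\ continuous (grad f).

(* Subdifferential of convex analysis of an extended-real-valued function;
   it is empty where h is not finite. *)
Definition subdiff (h : 'cV[R]_N -> \bar R) (w : 'cV[R]_N) : set 'cV[R]_N :=
  [set xi | h w \is a fin_num /\
            forall w', (h w + (dot xi (w' - w))%:E <= h w')%E].

End vectors.

(* \partial^c-stationary points of min { g w - h w | M w <= r }.  The function h is
   allowed to be extended-real-valued because optimal value functions are. *)
Definition dc_stationary {R : realType} {N K : nat}
    (M : 'M[R]_(K, N)) (r : 'cV[R]_K)
    (g : 'cV[R]_N -> R) (h : 'cV[R]_N -> \bar R) (w : 'cV[R]_N) : Prop :=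
  vle (M *m w) r /\
  exists zeta : 'cV[R]_K,
    (exists2 xi, subdiff h w xi & 0 = grad g w - xi + M^T *m zeta) /\
    nneg_perp zeta (r - M *m w).

Section bilevel.
Context {R : realType} {n m p q : nat}.
Variables (A : 'M[R]_(p, n)) (B : 'M[R]_(p, m)) (b : 'cV[R]_p) (c : 'cV[R]_m).
Variables (C : 'M[R]_(q, n)) (D : 'M[R]_(q, m)) (d : 'cV[R]_q).

(* { (x, y) | A x + B y <= b }; also used with C, D, d. *)
Definition joint_feasible (k : nat) (E : 'M[R]_(k, n)) (F : 'M[R]_(k, m))
    (e : 'cV[R]_k) : set 'cV[R]_(n + m) :=
  [set w | vle (E *m usubmx w + F *m dsubmx w) e].

Definition Zl : set 'cV[R]_(n + m) := joint_feasible A B b.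
Definition Zu : set 'cV[R]_(n + m) := joint_feasible C D d.

Definition Psi (x : 'cV[R]_n) : set 'cV[R]_m :=
  [set y | vle (A *m x + B *m y) b /\
           forall y', vle (A *m x + B *m y') b -> dot c y <= dot c y'].

Definition vartheta (x : 'cV[R]_n) : \bar R :=
  ereal_inf [set (dot c y)%:E | y in [set y | vle (A *m x + B *m y) b]].

Definition dom_vartheta : set 'cV[R]_n :=
  [set x | (`|vartheta x| < +oo)%E].

Definition BPP_feasible (x : 'cV[R]_n) (y : 'cV[R]_m) : Prop :=
  vle (C *m x + D *m y) d /\ Psi x y.

Definition penalty_stationary (f1 f2 : 'cV[R]_(n + m) -> R) (sigma : R)
    (w : 'cV[R]_(n + m)) : Prop :=
  dc_stationary (block_mx A B C D) (col_mx b d)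
    (fun w => f1 w + sigma * dot c (dsubmx w))
    (fun w => ((f2 w)%:E + sigma%:E * vartheta (usubmx w))%E) w.

(* An infinite run of the penalty-DC-method: the stopping test fails at every
   iteration.  The subproblem solver enters only through its output, which is
   required to be a stationary point. *)
Definition penalty_DC_run (f1 f2 : 'cV[R]_(n + m) -> R) (gamma : R)
    (sigma : nat -> R) (x : nat -> 'cV[R]_n) (y : nat -> 'cV[R]_m) : Prop :=
  [/\ 0 < sigma 0%N, 1 < gamma,
      (Zu `&` Zl) (col_mx (x 0%N) (y 0%N)) &
      forall k : nat,
        [/\ penalty_stationary f1 f2 (sigma k) (col_mx (x k.+1) (y k.+1)),
            ~ Psi (x k.+1) (y k.+1) &
            sigma k.+1 = gamma * sigma k]].

End bilevel.

(* Main.v *)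
Require Import Defs.
From HB Require Import structures.
From mathcomp Require Import all_boot all_order all_algebra.
From mathcomp Require Import all_classical all_reals all_analysis.
From mathcomp Require Import ring lra.
Import Order.TTheory GRing.Theory Num.Theory.
Import numFieldNormedType.Exports.
Local Open Scope classical_set_scope.
Local Open Scope ring_scope.

(** Why the theorem holds.

    At an iterate w = (x, y) produced with penalty parameter sigma, the function
    subtracted in the penalized problem is f2 + sigma * vartheta.  Since f2 is
    smooth, a subgradient of this function is grad f2 plus sigma times a
    subgradient of vartheta, and the affine Farkas lemma turns a subgradient of
    vartheta at x into A^T l, where l is an optimal solution of the dual program
      max (A x - b)^T l   subject to   B^T l = -c, l >= 0
    ([subdiff_penalty]).  As c = - B^T l, stationarity therefore reads
      grad f(w) = - M^T zeta + [A B]^T (sigma l),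
    where M stacks all constraints and zeta >= 0 is complementary to their
    slacks ([penalty_stationary_multipliers]).

    The penalty parameters tend to infinity, so neither zeta nor sigma * l need
    be bounded and no limit of multipliers can be taken.  Two polyhedral facts
    replace compactness.

    - Stability: for w near the limit point, an optimal solution of the dual
      program at x is also optimal at xbar, because only finitely many supports
      occur and optimality depends on the support alone ([lp_argmax_near]).  So
      sigma * l is complementary to the lower-level slack at (xbar, ybar), and
      likewise zeta is complementary to the slacks there ([perp_near]).

    - Closedness: with complementarity at the limit point imposed as a linear
      equation, the unknowns (zeta, sigma * l, sigma) are the nonnegative
      solutions of a linear system whose matrix does not depend on the iterate;
      only its right-hand side, built from grad f(w), does.  Finitely generated
      cones are closed, a direct consequence of the Farkas lemma, hence the
      system is still solvable at the limit ([cone_limit]).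

    The limit system provides l'' >= 0 and s >= 0 with B^T l'' + s c = 0.  When
    s > 0, the multiplier lambda' is l'' / s.  When s = 0, l'' is a recession
    direction of the dual feasible set; as vartheta is finite around xbar,
    A^T l'' = 0, so l'' contributes nothing and any optimal dual solution at
    xbar can serve as lambda' ([dehomogenize_dual]). *)

(** * Inner product and componentwise order *)

Section dot.
#[local] Set Implicit Arguments.
#[local] Unset Strict Implicit.
Context {R : realType}.

Lemma dotE {N} (u v : 'cV[R]_N) : dot u v = \sum_i u i 0 * v i 0.
Proof. by rewrite /dot mxE; apply: eq_bigr => i _; rewrite mxE. Qed.

Lemma dotC {N} (u v : 'cV[R]_N) : dot u v = dot v u.
Proof. by rewrite !dotE; apply: eq_bigr => i _; rewrite mulrC. Qed.

Lemma dotDr {N} (u v w : 'cV[R]_N) : dot u (v + w) = dot u v + dot u w.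
Proof. by rewrite /dot mulmxDr mxE. Qed.

Lemma dotNr {N} (u v : 'cV[R]_N) : dot u (- v) = - dot u v.
Proof. by rewrite /dot mulmxN mxE. Qed.

Lemma dotZr {N} a (u v : 'cV[R]_N) : dot u (a *: v) = a * dot u v.
Proof. by rewrite /dot -scalemxAr mxE. Qed.

Lemma dot0r {N} (u : 'cV[R]_N) : dot u 0 = 0.
Proof. by rewrite /dot mulmx0 mxE. Qed.

Lemma dotDl {N} (u v w : 'cV[R]_N) : dot (u + v) w = dot u w + dot v w.
Proof. by rewrite !(dotC _ w) dotDr. Qed.

Lemma dotNl {N} (u v : 'cV[R]_N) : dot (- u) v = - dot u v.
Proof. by rewrite !(dotC _ v) dotNr. Qed.

Lemma dotZl {N} a (u v : 'cV[R]_N) : dot (a *: u) v = a * dot u v.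
Proof. by rewrite !(dotC _ v) dotZr. Qed.

Lemma dot0l {N} (u : 'cV[R]_N) : dot 0 u = 0.
Proof. by rewrite dotC dot0r. Qed.

Lemma dotBr {N} (u v w : 'cV[R]_N) : dot u (v - w) = dot u v - dot u w.
Proof. by rewrite dotDr dotNr. Qed.

Lemma dotBl {N} (u v w : 'cV[R]_N) : dot (u - v) w = dot u w - dot v w.
Proof. by rewrite dotDl dotNl. Qed.

Lemma dot_mulmx {N K} (M : 'M[R]_(N, K)) u v : dot u (M *m v) = dot (M^T *m u) v.
Proof. by rewrite /dot trmx_mul trmxK mulmxA. Qed.

Lemma dot_col_mx {N K} (a b : 'cV[R]_N) (c d : 'cV[R]_K) :
  dot (col_mx a c) (col_mx b d) = dot a b + dot c d.
Proof. by rewrite /dot tr_col_mx mul_row_col mxE. Qed.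

Lemma dot_ge0 {N} (u v : 'cV[R]_N) : vle 0 u -> vle 0 v -> 0 <= dot u v.
Proof.
move=> u0 v0; rewrite dotE; apply: sumr_ge0 => i _.
by apply: mulr_ge0; [move: (u0 i)|move: (v0 i)]; rewrite mxE.
Qed.

Lemma dotvv_le0 {N} (u : 'cV[R]_N) : dot u u <= 0 -> u = 0.
Proof.
rewrite dotE => h.
have s0 i : true -> 0 <= u i 0 * u i 0 by move=> _; rewrite -expr2 sqr_ge0.
have /eqP : \sum_i u i 0 * u i 0 = 0 by apply/eqP; rewrite eq_le h sumr_ge0.
rewrite psumr_eq0 // => /allP E; apply/matrixP => i j.
rewrite (ord1 j) mxE; apply/eqP.
by have := E i (mem_index_enum i); rewrite /= mulf_eq0 orbb.
Qed.

Lemma vle_subl {N} (u v : 'cV[R]_N) : vle 0 (v - u) <-> vle u v.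
Proof.
by split=> h i; have := h i; rewrite !mxE subr_ge0.
Qed.

Lemma vle0_col_mx {N K} (u : 'cV[R]_N) (v : 'cV[R]_K) :
  vle 0 (col_mx u v) <-> vle 0 u /\ vle 0 v.
Proof.
split=> [h|[hu hv] i].
  by split=> i; [have := h (lshift _ i)|have := h (rshift _ i)];
    rewrite ?col_mxEu ?col_mxEd !mxE.
rewrite mxE; case: (split_ordP i) => j ->.
  by rewrite col_mxEu; have := hu j; rewrite mxE.
by rewrite col_mxEd; have := hv j; rewrite mxE.
Qed.

Lemma vle00 {N} : vle (0 : 'cV[R]_N) 0.
Proof. by move=> i. Qed.

Lemma vle0Z {N} a (u : 'cV[R]_N) : 0 <= a -> vle 0 u -> vle 0 (a *: u).
Proof.
by move=> a0 hu i; have := hu i; rewrite !mxE => *; rewrite mulr_ge0.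
Qed.

Lemma vle0_scalar (a : R) : vle 0 (a%:M : 'cV[R]_1) <-> 0 <= a.
Proof.
split=> [/(_ 0)|h i]; first by rewrite !mxE eqxx mulr1n.
by rewrite (ord1 i) !mxE eqxx mulr1n.
Qed.

Lemma mx11_dot {N} (u v : 'cV[R]_N) : u^T *m v = (dot u v)%:M.
Proof. by rewrite [LHS]mx11_scalar. Qed.

End dot.

(** * The Farkas lemma *)

Section farkas.
#[local] Set Implicit Arguments.
#[local] Unset Strict Implicit.
Context {R : realType}.

(** Bartl's algebraic proof, by induction on the number of generators (the columns
    of [G]).  If the hypothesis fails for the columns other than the first one [a],
    some [u0] is nonnegative on these columns and negative on [g], hence negative
    on [a].  Subtracting multiples of [a] from [g] and from the other columns so
    that they all vanish on [u0] gives an instance with one generator less. *)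
Lemma farkas N K (G : 'M[R]_(N, K)) (g : 'cV[R]_N) :
  (forall u, vle 0 (G^T *m u) -> 0 <= dot g u) ->
  exists2 z, vle 0 z & g = G *m z.
Proof.
elim: K G g => [|K IH] G g Hg.
  exists 0; first exact: vle00.
  rewrite mulmx0; apply: dotvv_le0; rewrite -oppr_ge0 -dotNr; apply: Hg.
  by case.
move: G Hg; rewrite -[K.+1]/(1 + K)%N => G.
rewrite -[G]hsubmxK; move: (lsubmx G) (rsubmx G) => {G} a G Hg.
have [Hg'|/existsNP[u0 /not_implyP[Gu0 /negP]]] :=
    pselect (forall u, vle 0 (G^T *m u) -> 0 <= dot g u).
  have [z z0 ->] := IH _ _ Hg'; exists (col_mx 0 z).
    by apply/vle0_col_mx; split=> //; exact: vle00.
  by rewrite mul_row_col mulmx0 add0r.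
rewrite -ltNge => gu0.
have au0 : dot a u0 < 0.
  rewrite ltNge; apply/negP => au0; move: gu0; rewrite ltNge => /negP; apply.
  apply: Hg; rewrite tr_row_mx mul_col_mx mx11_dot.
  by apply/vle0_col_mx; split=> //; apply/vle0_scalar.
have au0n : dot a u0 != 0 by rewrite lt_eqF.
set t := dot a u0 in au0 au0n.
pose G' := G - t^-1 *: (a *m (u0^T *m G)).
pose g' := g - (dot g u0 / t) *: a.
have [u Gu|z z0 gz] := IH G' g'.
  pose u' := u - (dot a u / t) *: u0.
  have au' : dot a u' = 0 by rewrite dotBr dotZr divfK // subrr.
  have Gu' : G^T *m u' = G'^T *m u.
    rewrite /u' /G' mulmxBr linearB /= mulmxBl; congr (_ - _).
    rewrite -scalemxAr linearZ /= !trmx_mul trmxK -scalemxAl -!mulmxA mx11_dot.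
    by rewrite !mul_mx_scalar -scalemxAr scalerA mulrC.
  have : 0 <= dot g u'.
    apply: Hg; rewrite tr_row_mx mul_col_mx mx11_dot au' Gu'.
    by apply/vle0_col_mx; split=> //; apply/vle0_scalar.
  suff -> : dot g u' = dot g' u by [].
  by rewrite /u' /g' dotBr dotBl dotZr dotZl; ring.
(* the coefficient of a once the subtracted multiples are put back *)
pose s := t^-1 * (dot g u0 - dot (G^T *m u0) z).
exists (col_mx s%:M z).
  apply/vle0_col_mx; split=> //; apply/vle0_scalar.
  rewrite /s mulr_le0 ?invr_le0 ?(ltW au0) // subr_le0 (le_trans (ltW gu0)) //.
  exact: dot_ge0.
rewrite mul_row_col mul_mx_scalar.
have -> : g = g' + (dot g u0 / t) *: a by rewrite /g' subrK.
rewrite gz /G' mulmxBl -scalemxAl -!mulmxA mx11_dot mul_mx_scalar scalerA.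
rewrite dot_mulmx /s mulrBr scalerBl (mulrC t^-1 (dot g u0)).
by rewrite -addrA addrC (addrC (- _)).
Qed.

(** The homogeneous lemma applied to the cone over the polyhedron, that is to the
    pairs [(w, t)] with [M w + |t| r >= 0] and [t <= 0]: where [t < 0] the point
    [w / t] lies in the polyhedron, and where [t = 0] the vector [- w] is one of
    its recession directions, along which [a] cannot decrease. *)
Lemma affine_farkas N K (M : 'M[R]_(K, N)) (r : 'cV[R]_K) (a : 'cV[R]_N) tau :
  (exists w, vle (M *m w) r) ->
  (forall w, vle (M *m w) r -> tau <= dot a w) ->
  exists l, [/\ vle 0 l, - a = M^T *m l & tau <= - dot r l].
Proof.
move=> [w0 Mw0] H.
have /farkas[] :
  forall u : 'cV_(N + 1),
    vle 0 ((block_mx M^T 0 (- r^T) (- 1%:M))^T *m u) ->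
    0 <= dot (col_mx (- a) tau%:M) u.
- move=> u; rewrite -[u]vsubmxK [dsubmx u]mx11_scalar.
  move: (usubmx u) (dsubmx u 0 0) => {u} w t.
  rewrite tr_block_mx mul_block_col trmx0 mul0mx add0r dot_col_mx.
  rewrite !linearN /= !trmxK !mul_mx_scalar trmx1 !scalerN scalemx1.
  move=> /vle0_col_mx[h1 h2].
  have t0 : t <= 0.
    by have := h2 0; rewrite !mxE eqxx mulr1n oppr_ge0.
  rewrite [dot tau%:M _]dotE big_ord1 !mxE eqxx !mulr1n dotNl.
  have {}h1 i : t * r i 0 <= (M *m w) i 0.
    by have := h1 i; rewrite !mxE; lra.
  move: t0; rewrite le_eqVlt => /predU1P[t0|t0].
    rewrite t0 mulr0 addr0 oppr_ge0 leNgt; apply/negP => aw.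
    (* moving from w0 by s along - w brings a down to tau - 1 *)
    pose s := (dot a w0 - tau + 1) / dot a w.
    have s0 : 0 <= s.
      by rewrite divr_ge0 ?(ltW aw)// addr_ge0 // subr_ge0 H.
    have : tau <= dot a (w0 - s *: w).
      apply: H => i; rewrite mulmxBr -scalemxAr; have := Mw0 i; have := h1 i.
      rewrite t0 mul0r => hi; rewrite [X in _ -> X <= _]mxE => Hi.
      apply: le_trans Hi; rewrite gerDl 2!mxE oppr_le0 mulr_ge0 //.
    rewrite dotBr dotZr divfK ?gt_eqF //; lra.
  have : tau <= dot a (t^-1 *: w).
    apply: H => i; rewrite -scalemxAr mxE mulrC ler_ndivrMr // mulrC.
    exact: h1.
  rewrite dotZr mulrC ler_ndivlMr //; lra.
- move=> z; rewrite -[z]vsubmxK [dsubmx z]mx11_scalar.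
  move: (usubmx z) (dsubmx z 0 0) => {z} l s /vle0_col_mx[l0 /vle0_scalar s0].
  rewrite mul_block_col mul0mx addr0 => /eq_col_mx[h1 h2].
  exists l; split=> //.
  move: h2; rewrite !mulNmx mx11_dot mul1mx => /matrixP/(_ 0 0).
  rewrite !mxE eqxx !mulr1n; lra.
Qed.

End farkas.

(** * Continuity, and closedness of finitely generated cones *)

Section continuity.
Context {R : realType}.

Lemma dot_continuous {N} (u : 'cV[R]_N) : continuous (dot u).
Proof.
have -> : dot u = fun v => \sum_i u i 0 * v i 0.
  by apply/funext => v; rewrite dotE.
move=> v; apply: (@cvg_big R _ +%R 0 _ _ _ (nbhs v)) => [|i _].
  exact: add_continuous.
by apply: cvgM; [exact: cvg_cst|exact: coord_continuous].
Qed.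

Lemma affine_dot_continuous {N K} (M : 'M[R]_(K, N)) a l :
  continuous (fun w => dot (M *m w + a) l).
Proof.
have -> : (fun w => dot (M *m w + a) l) = fun w => dot (M^T *m l) w + dot a l.
  by apply/funext => w; rewrite dotDl [dot (M *m w) l]dotC dot_mulmx.
move=> w; apply: (cvgD (F := nbhs w)); last exact: cvg_cst.
exact: dot_continuous.
Qed.

#[local] Set Implicit Arguments.
#[local] Unset Strict Implicit.

(** A limit point of a finitely generated cone stays in it: otherwise Farkas gives
    a half-space containing the cone and missing the limit.  The
    separation sees [h] only through [dot u], so this is where continuity is asked. *)
Lemma cone_limit (T : topologicalType) N K (G : 'M[R]_(N, K)) (h : T -> 'cV[R]_N)
    (S : set T) (t : T) :
  (forall u, {for t, continuous (fun s => dot u (h s))}) ->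
  closure S t ->
  (forall s, S s -> exists2 z, vle 0 z & h s = G *m z) ->
  exists2 z, vle 0 z & h t = G *m z.
Proof.
move=> hc St HS; apply: farkas => u Gu.
rewrite leNgt dotC; apply/negP => hu.
have [s [Ss]] := St _ (cvgr_lt _ (hc u) _ hu).
have [z z0 ->] := HS s Ss.
by rewrite dot_mulmx ltNge dot_ge0.
Qed.

End continuity.

(** * Stability of complementarity and of linear programs *)

Section stability.
Context {R : realType}.
#[local] Set Implicit Arguments.
#[local] Unset Strict Implicit.

(** Constraints that are inactive at [w] remain inactive nearby, so multipliers at
    nearby points vanish on them. *)
Lemma perp_near {N K} (M : 'M[R]_(K, N)) (r : 'cV[R]_K) w :
  vle (M *m w) r ->
  \forall w' \near w, forall z, nneg_perp z (r - M *m w') -> vle (M *m w') r ->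
    dot (r - M *m w) z = 0.
Proof.
move=> wr.
have : \forall w' \near w, forall i : 'I_K,
    (M *m w) i 0 < r i 0 -> (M *m w') i 0 < r i 0.
  apply: (@filter_forall _ _ _ (nbhs w)) => i.
  have [lt|_] := ltP ((M *m w) i 0) (r i 0); last by near=> w'.
  have E w' : dot (M *m w' + 0) (delta_mx i 0) = (M *m w') i 0.
    rewrite addr0 dotE (bigD1 i) //= big1 => [|k ki].
      by rewrite [delta_mx _ _ _ _]mxE !eqxx mulr1 addr0.
    by rewrite [delta_mx _ _ _ _]mxE (negPf ki) mulr0.
  have := affine_dot_continuous M 0 (delta_mx i 0) w.
  rewrite /continuous_at E => /(cvgr_lt (F := nbhs w)) /(_ _ lt).
  by apply: filterS => w'; rewrite E.
apply: filterS => w' act z [z0 perp] w'r.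
rewrite dotE big1 // => i _.
have zi i' : 0 <= z i' 0 by have := z0 i'; rewrite mxE.
have [lt|ge] := ltP ((M *m w) i 0) (r i 0); last first.
  suff -> : (r - M *m w) i 0 = 0 by rewrite mul0r.
  rewrite mxE [X in _ + X]mxE; apply/eqP; rewrite subr_eq0 eq_le ge.
  exact: wr.
suff -> : z i 0 = 0 by rewrite mulr0.
move: perp; rewrite dotE => /eqP; rewrite psumr_eq0 => [/allP|k _]; last first.
  have := w'r k; rewrite !mxE -subr_ge0 => *.
  by rewrite mulr_ge0.
move=> /(_ i (mem_index_enum i)) /=; rewrite mulf_eq0 => /orP[/eqP//|].
have := act i lt; rewrite !mxE subr_eq0 => h /eqP h'; move: h.
by rewrite -h' ltxx.
Unshelve. all: by end_near. Qed.

(** The feasible set is in standard form so that optimality of a feasible vector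
    can be read off its support. *)
Definition lp_argmax {N K} (E : 'M[R]_(N, K)) (e : 'cV[R]_N) (g l : 'cV[R]_K) :=
  [/\ vle 0 l, E *m l = e &
      forall l', vle 0 l' -> E *m l' = e -> dot g l' <= dot g l].

(** A maximizer [l] can be moved a little way in the direction [l - l'] when the
    support of [l'] is contained in its own, so [l'] is at least as good. *)
Lemma lp_argmax_face N K (E : 'M[R]_(N, K)) e g l l' :
  lp_argmax E e g l -> vle 0 l' -> E *m l' = e ->
  (forall i, l i 0 = 0 -> l' i 0 = 0) -> dot g l <= dot g l'.
Proof.
move=> [l0 El lmax] l'0 El' supp.
have {}l0 i : 0 <= l i 0 by have := l0 i; rewrite mxE.
have {}l'0 i : 0 <= l' i 0 by have := l'0 i; rewrite mxE.
have l'1 i : 0 < l' i 0 + 1 by rewrite ltr_wpDl.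
(* the denominators are shifted by 1 because l' i may vanish *)
pose t := \big[Order.min/1]_(i | 0 < l i 0) (l i 0 / (l' i 0 + 1)).
have t0 : 0 < t by apply: lt_bigmin => // i li; rewrite divr_gt0.
have tl' i : t * l' i 0 <= l i 0.
  have [li|li] := ltP 0 (l i 0); last first.
    by rewrite supp ?mulr0 //; apply/eqP; rewrite eq_le li l0.
  have : t <= l i 0 / (l' i 0 + 1) by exact: bigmin_le_cond.
  rewrite ler_pdivlMr // => h; apply: le_trans h.
  by rewrite ler_wpM2l ?(ltW t0) // lerDl.
have := lmax (l + t *: (l - l')).
rewrite mulmxDr -scalemxAr mulmxBr El El' subrr scaler0 addr0.
have F : vle 0 (l + t *: (l - l')).
  move=> i; rewrite !mxE; have := tl' i; have := l0 i; nra.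
move=> /(_ F erefl); rewrite dotDr dotZr dotBr gerDl pmulr_rle0 //.
by rewrite subr_le0.
Qed.

(** Whether a feasible vector is optimal depends only on its support, and there
    are finitely many supports.  A support that is not optimal for [g t] is beaten
    strictly by some feasible [l1], and it is still beaten by [l1] for objectives
    close to [g t]. *)
Lemma lp_argmax_near (T : topologicalType) N K (E : 'M[R]_(N, K)) e
    (g : T -> 'cV[R]_K) (t : T) :
  (forall l, {for t, continuous (fun s => dot (g s) l)}) ->
  \forall s \near t, forall l, lp_argmax E e (g s) l -> lp_argmax E e (g t) l.
Proof.
move=> gc.
pose supp (l : 'cV[R]_K) := [set i | l i 0 != 0]%SET.
suff : \forall s \near t, forall J : {set 'I_K}, forall l,
    supp l = J -> lp_argmax E e (g s) l -> lp_argmax E e (g t) l.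
  by apply: filterS => s H l; apply: (H (supp l)).
apply: filter_forall => J.
have [[l0 [l00 El0 l0J nmax]]|none] := pselect (exists l0,
    [/\ vle 0 l0, E *m l0 = e, supp l0 = J & ~ lp_argmax E e (g t) l0]); last first.
  near=> s => l lJ [l0 El _]; apply: contrapT => nmax.
  by apply: none; exists l.
have [l1 [l10 El1 l01]] :
    exists l1, [/\ vle 0 l1, E *m l1 = e & dot (g t) l0 < dot (g t) l1].
  apply: contrapT => H; apply: nmax; split=> // l' l'0 El'.
  by rewrite leNgt; apply/negP => lt; apply: H; exists l'.
have : \forall s \near t, 0 < dot (g s) l1 - dot (g s) l0.
  by apply: (cvgr_gt (dot (g t) l1 - dot (g t) l0));
    [apply: cvgB; exact: gc|rewrite subr_gt0].
apply: filterS => s; rewrite subr_gt0 => lt01 l lJ lmax; exfalso.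
have : dot (g s) l <= dot (g s) l0.
  apply: (lp_argmax_face lmax) => // i li; apply/eqP; apply: contraTT isT => l0i.
  have : i \in supp l by rewrite lJ -l0J inE.
  by rewrite inE li eqxx.
by have [_ _ /(_ _ l10 El1)] := lmax; lra.
Unshelve. all: by end_near. Qed.

End stability.

(** * Gradients *)

Section gradients.
Context {R : realType}.
#[local] Set Implicit Arguments.
#[local] Unset Strict Implicit.

Lemma derive_dot_grad N (f : 'cV[R]_N -> R) w u :
  differentiable f w -> 'D_u f w = dot (grad f w) u.
Proof.
move=> df; rewrite deriveE // {1}[u]matrix_sum_delta linear_sum dotE.
apply: eq_bigr => i _; rewrite big_ord1 linearZ /= mxE deriveE //.
by rewrite mulrC.
Qed.

Lemma is_derive_dot N (a w u : 'cV[R]_N) : is_derive w u (dot a) (dot a u).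
Proof.
have C : (fun h => h^-1 *: ((dot a \o shift w) (h *: u) - dot a w)) @ 0^'
    --> dot a u.
  apply: cvg_near_cst; near=> h.
  rewrite /= dotDr addrK dotZr /GRing.scale /= mulKf //.
  near: h; exact: nbhs_dnbhs_neq.
by split; [apply/cvg_ex; exists (dot a u)|apply: cvg_lim].
Unshelve. all: by end_near. Qed.

Lemma grad_addZdot N (f : 'cV[R]_N -> R) s a w : differentiable f w ->
  grad (fun w => f w + s * dot a w) w = grad f w + s *: a.
Proof.
move=> df; apply/matrixP => i j; rewrite (ord1 j) !mxE.
have d1 : derivable f w (delta_mx i 0) by exact: diff_derivable.
have -> : (fun w => f w + s * dot a w) = f + dot (s *: a).
  by apply/funext => v; rewrite -dotZl.
have d2 := is_derive_dot (s *: a) w (delta_mx i 0).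
rewrite deriveD // derive_val dotZl dotE (bigD1 i) //= big1 => [|k ki].
  by rewrite mxE !eqxx mulr1 addr0.
by rewrite mxE (negPf ki) mulr0.
Qed.

Lemma gradB N (f g : 'cV[R]_N -> R) w : differentiable f w -> differentiable g w ->
  grad (fun w => f w - g w) w = grad f w - grad g w.
Proof.
move=> df dg; apply/matrixP => i j; rewrite !mxE.
by rewrite deriveB //; exact: diff_derivable.
Qed.

Lemma derive_ge N (f : 'cV[R]_N -> R) w u K : derivable f w u ->
  (forall t, 0 < t < 1 -> t * K <= f (w + t *: u) - f w) -> K <= 'D_u f w.
Proof.
move=> df H; apply: (cvgr_to_ge (cvg_dnbhs_at_right df)).
near=> t => /=.
have t0 : 0 < t by [].
rewrite {1}/GRing.scale /= ler_pdivlMl // (addrC (t *: u)); apply: H.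
by rewrite t0 /=; near: t; exact: nbhs_right_lt.
Unshelve. all: by end_near. Qed.

End gradients.

(** * Duality for the lower-level program *)

Section lower_level.
#[local] Set Implicit Arguments.
#[local] Unset Strict Implicit.
Context {R : realType} {n m p : nat}.
Variables (A : 'M[R]_(p, n)) (B : 'M[R]_(p, m)) (b : 'cV[R]_p) (c : 'cV[R]_m).

Lemma vartheta_le x y : vle (A *m x + B *m y) b ->
  (vartheta A B b c x <= (dot c y)%:E)%E.
Proof. by move=> h; apply: ereal_inf_lbound; exists y. Qed.

Lemma fine_vartheta_ge x tau : vartheta A B b c x \is a fin_num ->
  (forall y, vle (A *m x + B *m y) b -> tau <= dot c y) ->
  tau <= fine (vartheta A B b c x).
Proof.
move=> xfin h; rewrite -lee_fin fineK //.
by apply: le_ereal_inf_tmp => _ [y /h hy <-]; rewrite lee_fin.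
Qed.

Lemma lp_weak_duality x y l : vle 0 l -> B^T *m l = - c ->
  vle (A *m x + B *m y) b -> dot (A *m x - b) l <= dot c y.
Proof.
move=> l0 Bl /vle_subl /(dot_ge0 l0).
rewrite dotC dotBl dotDl dotBl [dot (B *m y) l]dotC dot_mulmx Bl dotNl; lra.
Qed.

(** The affine Farkas lemma for the constraints on [y] with [x] fixed: its bound
    closes the duality gap, which is the complementarity. *)
Lemma lp_strong_duality x y : Psi A B b c x y ->
  exists l, B^T *m l = - c /\ nneg_perp l (b - A *m x - B *m y).
Proof.
move=> [xy ymin].
have fe y' : vle (B *m y') (b - A *m x) <-> vle (A *m x + B *m y') b.
  by split => h i; have := h i; rewrite !mxE; lra.
have [|w /fe hw|l [l0 Bl lb]] := @affine_farkas R _ _ B (b - A *m x) c (dot c y).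
- by exists y; apply/fe.
- exact: ymin.
exists l; split=> //; split=> //; apply/le_anti/andP; split; last first.
  by apply: dot_ge0 => //; apply/vle_subl/fe.
rewrite dotBr dot_mulmx -Bl dotNl [dot l _]dotC; lra.
Qed.

(** Strong duality holds at the primal optimum [y], so a dual optimum leaves no
    duality gap, which is complementarity. *)
Lemma lp_argmax_perp x y l : Psi A B b c x y ->
  lp_argmax B^T (- c) (A *m x - b) l -> dot (b - A *m x - B *m y) l = 0.
Proof.
move=> Pxy [l0 Bl lmax]; have [l' [Bl' [l'0 perp]]] := lp_strong_duality Pxy.
apply/le_anti/andP; split; last first.
  apply: dot_ge0 => // i; have := (proj1 Pxy) i; rewrite !mxE; lra.
have := lmax _ l'0 Bl'; move: perp.
rewrite dotC !dotBl ![dot (B *m _) _]dotC !dot_mulmx Bl Bl'.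
lra.
Qed.

(** The vector [l] is a recession direction of the dual feasible set.  A step from
    [x] along [A^T l] would make the dual unbounded, so the lower-level program
    infeasible, unless [A^T l = 0]; but near [x] it is feasible. *)
Lemma dual_recession x y l : (dom_vartheta A B b c)° x ->
  vle 0 l -> B^T *m l = 0 -> dot (b - A *m x - B *m y) l = 0 -> A^T *m l = 0.
Proof.
move=> xint l0 Bl perp; set v := A^T *m l.
have [t [t0 domt]] : exists t : R, 0 < t /\ dom_vartheta A B b c (x + t *: v).
  have c0 : (fun t : R => x + t *: v) @ 0^'+ --> x.
    rewrite -[X in _ --> X]addr0 -(scale0r v).
    apply: cvgD; first exact: cvg_cst.
    by apply: cvgZr_tmp; exact: cvg_at_right_filter.
  have : \forall t \near 0^'+, dom_vartheta A B b c (x + t *: v).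
    exact: (c0 _ xint).
  move=> H; have [t [tpos tdom]] := filter_ex (filterI (nbhs_right_gt 0) H).
  by exists t.
have [y' y'f] : exists y', vle (A *m (x + t *: v) + B *m y') b.
  apply: contrapT => none; move: domt; rewrite /dom_vartheta /= /vartheta.
  rewrite (_ : [set y | _] = set0) ?image_set0 ?ereal_inf0 //.
  by apply/seteqP; split=> // z hz; apply: none; exists z.
apply: dotvv_le0; rewrite -(pmulr_rle0 _ t0).
move/vle_subl : y'f => /dot_ge0 - /(_ _ l0) slack.
rewrite !dotBl ![dot (_ *m _) l]dotC !dot_mulmx Bl dot0l -/v in perp.
rewrite dotBl dotDl ![dot (_ *m _) l]dotC !dot_mulmx Bl dot0l -/v in slack.
rewrite dotDr dotZr in slack; lra.
Qed.

(** The pair [(l, s)] is a multiplier of the lower-level program in homogenized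
    form.  Dividing by [s] gives a genuine dual solution; if [s = 0], then [l] is
    annihilated by both transposes and can be dropped. *)
Lemma dehomogenize_dual x y l s : (dom_vartheta A B b c)° x -> Psi A B b c x y ->
  vle 0 l -> 0 <= s -> B^T *m l + s *: c = 0 ->
  dot (b - A *m x - B *m y) l = 0 ->
  exists l', [/\ A^T *m (s *: l') = A^T *m l, B^T *m (s *: l') = B^T *m l,
    B^T *m l' = - c & nneg_perp l' (b - A *m x - B *m y)].
Proof.
move=> xint Pxy l0; rewrite le_eqVlt => /predU1P[<-|s0] Bl lperp.
  have [l' [Bl' l'perp]] := lp_strong_duality Pxy.
  move: Bl; rewrite !scale0r addr0 => Bl.
  by exists l'; rewrite scale0r !mulmx0 Bl (dual_recession xint l0 Bl lperp).
have sK : s *: (s^-1 *: l) = l by rewrite scalerA divff ?gt_eqF // scale1r.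
exists (s^-1 *: l); rewrite sK; split=> //.
  move/eqP: Bl; rewrite addr_eq0 -scalemxAr => /eqP ->.
  by rewrite scalerN scalerA mulVf ?gt_eqF // scale1r.
split; first by apply: vle0Z => //; rewrite invr_ge0 ltW.
by rewrite dotC dotZr lperp mulr0.
Qed.

(** The sum rule for the subdifferential and the formula for the subdifferential
    of the optimal value function, proved together.  Only [f] is differentiable,
    and [vartheta] may be infinite; therefore the subgradient inequality is tested
    on segments towards a feasible point [(x', y')], where the convexity estimate
    [vartheta (x + t (x' - x)) <= (1 - t) vartheta x + t c^T y'] holds for [t < 1].
    Dividing by [t] and letting it tend to 0 gives an inequality that is affine in
    [(x', y')]. *)
Lemma subdiff_penalty (f : 'cV[R]_(n + m) -> R) s w xi : 0 < s ->
  differentiable f w -> Zl A B b w ->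
  subdiff (fun w => ((f w)%:E + s%:E * vartheta A B b c (usubmx w))%E) w xi ->
  exists l, lp_argmax B^T (- c) (A *m usubmx w - b) l /\
            xi = grad f w + s *: col_mx (A^T *m l) 0.
Proof.
move=> s0 df wf [hfin hsub].
set x := usubmx w in wf hfin hsub *; set y := dsubmx w in wf.
have xfin : vartheta A B b c x \is a fin_num.
  move: hfin; rewrite fin_numD => /andP[_].
  by case: (vartheta A B b c x) => [r| |] //; rewrite ?gt0_muley ?gt0_muleNy ?lte_fin.
set V := fine (vartheta A B b c x).
have sub1 w' y' : vle (A *m usubmx w' + B *m y') b ->
    f w + s * V + dot xi (w' - w) <= f w' + s * dot c y'.
  move=> /vartheta_le h; rewrite -lee_fin; apply: le_trans (le_trans (hsub w') _).
    by rewrite !EFinD EFinM fineK.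
  by rewrite EFinD EFinM leeD2l // lee_wpmul2l // lee_fin ltW.
pose phi := xi - grad f w.
have sub2 x' y' e : vle (A *m x' + B *m y') b ->
    dot phi (col_mx (x' - x) e) <= s * (dot c y' - V).
  move=> hx'; set u := col_mx _ _.
  suff : dot xi u - s * (dot c y' - V) <= 'D_u f w.
    by rewrite derive_dot_grad // /phi dotBl; lra.
  apply: derive_ge; first exact: diff_derivable.
  move=> t /andP[t0 t1].
  have tV y0 : vle (A *m x + B *m y0) b ->
    s^-1 * (f w + s * V + t * dot xi u - f (w + t *: u) - s * t * dot c y') <=
    (1 - t) * dot c y0.
    move=> hy0; rewrite ler_pdivrMl //.
    have := sub1 (w + t *: u) ((1 - t) *: y0 + t *: y').
    rewrite [w + _ - w]addrC addKr dotZr dotDr !dotZr.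
    suff F : vle (A *m usubmx (w + t *: u) + B *m ((1 - t) *: y0 + t *: y')) b.
      by move=> /(_ F); lra.
    rewrite linearD linearZ /= col_mxKu -/x => i.
    have := hx' i; have := hy0 i.
    rewrite !mulmxDr -!scalemxAr mulmxBr !mxE; nra.
  have : s^-1 * (f w + s * V + t * dot xi u - f (w + t *: u) - s * t * dot c y')
      / (1 - t) <= V.
    apply: fine_vartheta_ge => // y0 /tV.
    by rewrite ler_pdivrMr ?subr_gt0 // [dot c y0 * _]mulrC.
  rewrite ler_pdivrMr ?subr_gt0 // ler_pdivrMl //; lra.
(* the component e in sub2 is arbitrary, so phi has no y-part *)
have phiy : dsubmx phi = 0.
  apply: dotvv_le0; rewrite leNgt; apply/negP => pos.
  have := sub2 x y (((s * (dot c y - V) + 1) / dot (dsubmx phi) (dsubmx phi))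
                     *: dsubmx phi) wf.
  rewrite -{1}[phi]vsubmxK dot_col_mx subrr dot0r add0r dotZr divfK ?gt_eqF //.
  lra.
pose v := s^-1 *: usubmx phi.
have [|w' hw'|l [l0 Ml lb]] :=
    @affine_farkas R _ _ (row_mx A B) b (col_mx (- v) c) (V - dot v x).
- by exists w; rewrite -[w]vsubmxK mul_row_col.
- move: hw'; rewrite -[w']vsubmxK mul_row_col => hw'.
  have := sub2 (usubmx w') (dsubmx w') 0 hw'.
  rewrite -{1}[phi]vsubmxK !dot_col_mx dot0r addr0 dotNl /v !dotZl dotBr.
  rewrite -ler_pdivrMl // mulrBr; lra.
move: Ml; rewrite tr_row_mx mul_col_mx -[- col_mx _ _]scaleN1r scale_col_mx.
rewrite !scaleN1r opprK => /eq_col_mx[vA Bl].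
exists l; split.
  split=> // l' l'0 Bl'; apply: (@le_trans _ _ V).
    by apply: fine_vartheta_ge => // y0 hy0; exact: lp_weak_duality.
  by move: lb; rewrite dotBl [dot (A *m x) l]dotC dot_mulmx -vA; lra.
rewrite -vA /v scale_col_mx scalerA divff ?gt_eqF // scale1r scaler0 -phiy.
by rewrite vsubmxK /phi addrC subrK.
Qed.

End lower_level.

(** * The stationarity system of the penalized problems *)

Section penalized.
Context {R : realType} {n m p q : nat}.
Variables (A : 'M[R]_(p, n)) (B : 'M[R]_(p, m)) (b : 'cV[R]_p) (c : 'cV[R]_m).
Variables (C : 'M[R]_(q, n)) (D : 'M[R]_(q, m)) (d : 'cV[R]_q).
#[local] Set Implicit Arguments.
#[local] Unset Strict Implicit.

(** The term [sigma * c] from the penalty is absorbed into [(row_mx A B)^T *m l]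
    because dual feasibility says [c = - B^T l]. *)
Lemma penalty_stationary_multipliers (f1 f2 : 'cV[R]_(n + m) -> R) s w : 0 < s ->
  differentiable f1 w -> differentiable f2 w ->
  penalty_stationary A B b c C D d f1 f2 s w ->
  exists zeta l, [/\ vle (block_mx A B C D *m w) (col_mx b d),
    nneg_perp zeta (col_mx b d - block_mx A B C D *m w),
    lp_argmax B^T (- c) (A *m usubmx w - b) l &
    grad f1 w - grad f2 w =
      - ((block_mx A B C D)^T *m zeta) + s *: ((row_mx A B)^T *m l)].
Proof.
move=> s0 d1 d2 [wr [zeta [[xi xisub stat] perp]]].
have wl : Zl A B b w.
  rewrite /Zl /joint_feasible /= => i; have := wr (lshift _ i).
  by rewrite -[w]vsubmxK mul_block_col !col_mxEu col_mxKu col_mxKd.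
have [l [lmax xiE]] := subdiff_penalty s0 d2 wl xisub.
exists zeta, l; split=> //.
move: stat; have -> : (fun w => f1 w + s * dot c (dsubmx w)) =
    (fun w => f1 w + s * dot (col_mx (0 : 'cV_n) c) w).
  apply/funext => v; congr (_ + _ * _).
  by rewrite -[v in RHS]vsubmxK dot_col_mx dot0l add0r.
rewrite grad_addZdot // xiE tr_row_mx mul_col_mx; have [_ -> _] := lmax.
have -> : col_mx (A^T *m l) (- c) = col_mx (A^T *m l) 0 - col_mx 0 c.
  by rewrite -[- col_mx 0 c]scaleN1r scale_col_mx scaler0 scaleN1r add_col_mx addr0 add0r.
move=> stat; apply/eqP; rewrite -subr_eq0 [X in _ == X]stat; apply/eqP/matrixP => i j.
by rewrite !mxE; ring.
Qed.

(** The four block rows say: stationarity, homogenized dual feasibility of the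
    lower-level multiplier, and complementarity of the two groups of multipliers to
    the slacks [s1] (of all constraints) and [s2] (of the lower-level ones).
    Complementarity is a single linear equation since all quantities involved are
    nonnegative. *)
Definition multiplier_mx (s1 : 'cV[R]_(p + q)) (s2 : 'cV[R]_p) :
    'M[R]_((n + m) + (m + (1 + 1)), (p + q) + (p + 1)) :=
  col_mx (row_mx (- (block_mx A B C D)^T) (row_mx (row_mx A B)^T 0))
 (col_mx (row_mx 0 (row_mx B^T c))
 (col_mx (row_mx s1^T 0) (row_mx 0 (row_mx s2^T 0)))).

Lemma multiplier_mxP s1 s2 g zeta l s :
  col_mx g 0 = multiplier_mx s1 s2 *m col_mx zeta (col_mx l s%:M) <->
  [/\ g = - ((block_mx A B C D)^T *m zeta) + (row_mx A B)^T *m l,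
      B^T *m l + s *: c = 0, dot s1 zeta = 0 & dot s2 l = 0].
Proof.
rewrite /multiplier_mx !mul_col_mx !mul_row_col !mul0mx !addr0 !add0r.
rewrite mulNmx !mul_mx_scalar !mx11_dot -[0 in LHS]vsubmxK -[dsubmx 0]vsubmxK.
rewrite !linear0; split.
  move=> /eq_col_mx[-> /eq_col_mx[<- /eq_col_mx[e1 e2]]]; split=> //.
    by move/matrixP/(_ 0 0): e1; rewrite !mxE eqxx mulr1n => <-.
  by move/matrixP/(_ 0 0): e2; rewrite !mxE eqxx mulr1n => <-.
by move=> [-> -> -> ->]; rewrite raddf0.
Qed.

Lemma slack_col_mx x y :
  col_mx b d - block_mx A B C D *m col_mx x y =
  col_mx (b - A *m x - B *m y) (d - C *m x - D *m y).
Proof.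
rewrite mul_block_col -[- col_mx _ _]scaleN1r scale_col_mx.
by rewrite !scaleN1r add_col_mx !opprD !addrA.
Qed.

(** The matrix of the system is the one of the limit point, not of [w]: this is
    where both stability lemmas are used. *)
Lemma penalty_stationary_near (f1 f2 : 'cV[R]_(n + m) -> R) x y :
  (forall w, differentiable f1 w) -> (forall w, differentiable f2 w) ->
  vle (C *m x + D *m y) d -> Psi A B b c x y ->
  \forall w \near col_mx x y, forall s, 0 < s ->
    penalty_stationary A B b c C D d f1 f2 s w ->
    exists2 z, vle 0 z &
      col_mx (grad f1 w - grad f2 w) 0 =
      multiplier_mx (col_mx (b - A *m x - B *m y) (d - C *m x - D *m y))
                    (b - A *m x - B *m y) *m z.
Proof.
move=> d1 d2 xyu Pxy; have [xyl _] := Pxy.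
have xyr : vle (block_mx A B C D *m col_mx x y) (col_mx b d).
  apply/vle_subl; rewrite slack_col_mx; apply/vle0_col_mx.
  by split=> i; [have := xyl i|have := xyu i]; rewrite !mxE; lra.
have Aw w : row_mx A 0 *m w - b = A *m usubmx w - b.
  by rewrite -{1}[w]vsubmxK mul_row_col mul0mx addr0.
have dual_near := lp_argmax_near B^T (- c)
  (fun l => affine_dot_continuous (row_mx A 0) (- b) l (col_mx x y)).
apply: filterS (filterI dual_near (perp_near xyr)) => w [dualw actw] s s0 stat.
have [zeta [l [wr zperp lmax gE]]] :=
  penalty_stationary_multipliers s0 (d1 w) (d2 w) stat.
have [l0 Bl _] := lmax; have [zeta0 _] := zperp.
exists (col_mx zeta (col_mx (s *: l) s%:M)).
  apply/vle0_col_mx; split=> //; apply/vle0_col_mx; split.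
    by apply: vle0Z => //; exact: ltW.
  by apply/vle0_scalar; exact: ltW.
apply/multiplier_mxP; split.
- by rewrite -scalemxAr.
- by rewrite -scalemxAr Bl scalerN addNr.
- by rewrite -slack_col_mx; exact: actw.
- rewrite dotZr (lp_argmax_perp Pxy) ?mulr0 //.
  by have := dualw l; rewrite !Aw col_mxKu; apply.
Qed.

End penalized.

(** * Passage to the limit *)

Theorem theorem5p4 (R : realType) (n m p q : nat)
    (A : 'M[R]_(p, n)) (B : 'M[R]_(p, m))
    (C : 'M[R]_(q, n)) (D : 'M[R]_(q, m))
    (b : 'cV[R]_p) (c : 'cV[R]_m) (d : 'cV[R]_q)
    (f1 f2 : 'cV[R]_(n + m) -> R)
    (f1_convex : convex_function [set: 'cV[R]_(n + m)] f1)
    (f2_convex : convex_function [set: 'cV[R]_(n + m)] f2)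
    (f1_C1 : continuously_differentiable f1)
    (f2_C1 : continuously_differentiable f2)
    (dom_interior :
       [set x : 'cV[R]_n | exists y : 'cV[R]_m, Zl A B b (col_mx x y)]
         `<=` (dom_vartheta A B b c)°)
    (feasible_nonempty : Zu C D d `&` Zl A B b !=set0)
    (feasible_compact : compact (Zu C D d `&` Zl A B b))
    (gamma : R) (sigmak : nat -> R)
    (x : nat -> 'cV[R]_n) (y : nat -> 'cV[R]_m)
    (run : penalty_DC_run A B b c C D d f1 f2 gamma sigmak x y)
    (xbar : 'cV[R]_n) (ybar : 'cV[R]_m)
    (accumulation :
       cluster ((fun k => col_mx (x k) (y k)) @ \oo) (col_mx xbar ybar))
    (xybar_feasible : BPP_feasible A B b c C D d xbar ybar) :
  let gradf := grad (fun w => f1 w - f2 w) (col_mx xbar ybar) in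
  exists (lambda lambda' : 'cV[R]_p) (mu : 'cV[R]_q) (sigma : R),
    0 <= sigma /\
    0 = usubmx gradf + A^T *m (lambda - sigma *: lambda') + C^T *m mu /\
    0 = dsubmx gradf + B^T *m (lambda - sigma *: lambda') + D^T *m mu /\
    nneg_perp lambda (b - A *m xbar - B *m ybar) /\
    nneg_perp mu (d - C *m xbar - D *m ybar) /\
    0 = c + B^T *m lambda' /\
    nneg_perp lambda' (b - A *m xbar - B *m ybar).
Proof.
set wbar := col_mx xbar ybar in accumulation *; move=> gradf.
have [sigma00 gamma1 _ runk] := run.
have sigma_gt0 k : 0 < sigmak k.
  elim: k => // k IH; have [_ _ ->] := runk k.
  by rewrite mulr_gt0 // (lt_trans ltr01).
pose s2 := b - A *m xbar - B *m ybar; pose s3 := d - C *m xbar - D *m ybar.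
have [ubar Pbar] := xybar_feasible; have [lbar _] := Pbar.
have s20 : vle 0 s2 by move=> i; have := lbar i; rewrite !mxE; lra.
have s30 : vle 0 s3 by move=> i; have := ubar i; rewrite !mxE; lra.
have xint : (dom_vartheta A B b c)° xbar.
  apply: dom_interior; exists ybar.
  by rewrite /Zl /joint_feasible /= col_mxKu col_mxKd.
pose h w := col_mx (grad f1 w - grad f2 w) (0 : 'cV[R]_(m + (1 + 1))).
pose G := multiplier_mx A B c C D (col_mx s2 s3) s2.
have [z z0 hz] : exists2 z, vle 0 z & h wbar = G *m z.
  apply: (@cone_limit _ _ _ _ _ h [set w | exists2 z, vle 0 z & h w = G *m z]) => //.
    move=> u; rewrite -[u]vsubmxK.
    have E : (fun w => dot (usubmx u) (grad f1 w) - dot (usubmx u) (grad f2 w)) =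
        (fun w => dot (col_mx (usubmx u) (dsubmx u)) (h w)).
      by apply/funext => w; rewrite /h dot_col_mx dot0r addr0 dotBr.
    suff : {for wbar, continuous
        (fun w => dot (usubmx u) (grad f1 w) - dot (usubmx u) (grad f2 w))}.
      by rewrite /prop_for E.
    apply: (cvgB (F := nbhs wbar)).
      by apply: continuous_comp; [exact: f1_C1.2|exact: dot_continuous].
    by apply: continuous_comp; [exact: f2_C1.2|exact: dot_continuous].
  move=> V nV.
  have stat_near := penalty_stationary_near f1_C1.1 f2_C1.1 ubar Pbar.
  (* the starting point of the run need not be stationary and is discarded *)
  have tail : ((fun k => col_mx (x k) (y k)) @ \oo)
      [set w | exists k, w = col_mx (x k.+1) (y k.+1)].
    by exists 1%N => // -[//|k] _; exists k.
  have [w [[k wk] [Vw statw]]] := accumulation _ _ tail (filterI nV stat_near).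
  exists w; split=> //; apply: (statw (sigmak k)) => //.
  by rewrite wk; have [] := runk k.
move: z0 hz; rewrite -[z]vsubmxK -[dsubmx z]vsubmxK [dsubmx (dsubmx z)]mx11_scalar.
move: (usubmx z) (usubmx (dsubmx z)) (dsubmx (dsubmx z) 0 0) => {z} zeta l s.
move=> /vle0_col_mx[zeta0 /vle0_col_mx[l0 /vle0_scalar s0]].
move=> /multiplier_mxP[gE Bl zperp lperp].
have {gE} gE : gradf = - ((block_mx A B C D)^T *m zeta) + (row_mx A B)^T *m l.
  by rewrite -gE /gradf gradB //; [exact: f1_C1.1|exact: f2_C1.1].
move: zeta0 zperp gE; rewrite -[zeta]vsubmxK.
move: (usubmx zeta) (dsubmx zeta) => {zeta} lambda mu.
move=> /vle0_col_mx[lambda0 mu0]; rewrite dot_col_mx => perp.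
(* a vanishing sum of two nonnegative products: both vanish *)
have p1 := dot_ge0 s20 lambda0; have p2 := dot_ge0 s30 mu0.
rewrite tr_block_mx mul_block_col tr_row_mx mul_col_mx.
rewrite -[- col_mx _ _]scaleN1r scale_col_mx !scaleN1r add_col_mx => gE.
have [l' [Al' Bl'' Bl' l'perp]] := dehomogenize_dual xint Pbar l0 s0 Bl lperp.
exists lambda, l', mu, s; split=> //; rewrite gE col_mxKu col_mxKd -Al' -Bl''.
split; first by rewrite mulmxBr; apply/matrixP => i j; rewrite !mxE; ring.
split; first by rewrite mulmxBr; apply/matrixP => i j; rewrite !mxE; ring.
split; first by split=> //; rewrite dotC -/s2; lra.
split; first by split=> //; rewrite dotC -/s3; lra.
split; first by rewrite Bl' subrr.
exact: l'perp.
Qed.
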